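(* Let $R$ be an $F$-finite noetherian ring of characteristic $p$. If $R$ is strongly $F$-regular, then it is very strongly $F$-regular.
   Context: $p$ is a prime number; rings of characteristic $p$ are $\mathbb{F}_p$-algebras. For such a ring $R$ and $e\ge 0$, $R^{(-e)}$ denotes the ring $R$ viewed as an $R$-algebra via the $e$th Frobenius map $F^e:R\to R^{(-e)}$, $a\mapsto (a^{p^e})^{(-e)}$, where $r\in R$ viewed in $R^{(-e)}$ is written $r^{(-e)}$. $R$ is $F$-finite if $R^{(-1)}$ is a finitely generated $R$-module. $R^\circ := R\setminus\bigcup_{P\in\operatorname{Min} R}P$, where $\operatorname{Min} R$ is the set of minimal primes. For an $R$-module $M$ and a submodule $N\subset M$, $\operatorname{Cl}_R(N,M)$ is the set of $x\in M$ for which there exist $c\in R^\circ$ and $e_0\ge 1$ such that for all $e\ge e_0$ the element $x\otimes c^{(-e)}\in M/N\otimes_R R^{(-e)}$ is zero. A noetherian ring $R$ of characteristic $p$ is strongly $F$-regular if $\operatorname{Cl}_R(N,M)=N$ for every $R$-module $M$ and every submodule $N\subset M$. An $R$-linear map $M\to M'$ is $R$-pure if $W\otimes_R M\to W\otimes_R M'$ is injective for every $R$-module $W$. A noetherian ring $R$ of characteristic $p$ is very strongly $F$-regular if for any $c\in R^\circ$ there exists some $e>0$ such that the $R$-linear map $c^{(-e)}F^e: R\to R^{(-e)}$, $x\mapsto (cx^{p^e})^{(-e)}$, is $R$-pure. *)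

(* Defs.v *)
From HB Require Import structures.
From mathcomp Require Import all_boot all_algebra.
From mathcomp Require Import boolp.

Set Implicit Arguments.
Unset Strict Implicit.
Unset Printing Implicit Defensive.

Import GRing.Theory.
Local Open Scope ring_scope.
Local Open Scope quotient_scope.

(* Rings are [comPzRingType]s, so that the zero ring is not excluded.  Modules
   are arbitrary [lmodType]s and submodules are [submodClosed] predicates; in
   the presence of the classical axioms of [boolp], every type carries a choice
   structure and every subset is given by a boolean predicate. *)

Section QuotientModule.
Variables (R : pzRingType) (M : lmodType R) (N : submodClosed M).

Definition submod_pred : M -> bool := fun x => x \in N.

Fact submod_pred_zmod : zmod_closed submod_pred.
Proof. exact: GRing.submod_closedB (submodClosedP N). Qed.
HB.instance Definition _ := GRing.isZmodClosed.Build M submod_pred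
  submod_pred_zmod.
Definition submod_zmod : zmodClosed M := GRing.ZmodClosed.clone M submod_pred _.

Definition quotmod : Type := Quotient.quot submod_zmod.
HB.instance Definition _ := GRing.Zmodule.on quotmod.

Definition quotproj (x : M) : quotmod := \pi_(Quotient.quot submod_zmod) x.

Lemma quotprojP (x y : M) : quotproj x = quotproj y <-> x - y \in N.
Proof.
have -> : (x - y \in N) = (quotproj x == quotproj y).
  exact: (Quotient.idealrBE submod_zmod x y).
by split=> /eqP.
Qed.

Lemma quotproj_surj (q : quotmod) : exists x, q = quotproj x.
Proof. by exists (repr q); rewrite /quotproj reprK. Qed.

Lemma quotprojD (x y : M) : quotproj (x + y) = quotproj x + quotproj y.
Proof. by rewrite /quotproj piE. Qed.

Definition quotscale (a : R) (q : quotmod) : quotmod :=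
  quotproj (a *: repr (q : Quotient.quot submod_zmod)).

Lemma quotscaleE a x : quotscale a (quotproj x) = quotproj (a *: x).
Proof.
apply/quotprojP; rewrite -scalerBr rpredZ //; apply/quotprojP.
by rewrite /quotproj reprK.
Qed.

Fact quotscaleA a b q : quotscale a (quotscale b q) = quotscale (a * b) q.
Proof. by have [x ->] := quotproj_surj q; rewrite !quotscaleE scalerA. Qed.
Fact quotscale1 : left_id 1 quotscale.
Proof. by move=> q; have [x ->] := quotproj_surj q; rewrite quotscaleE scale1r. Qed.
Fact quotscaleDr : right_distributive quotscale +%R.
Proof.
move=> a q r; have [x ->] := quotproj_surj q; have [y ->] := quotproj_surj r.
by rewrite -quotprojD !quotscaleE scalerDr quotprojD.
Qed.
Fact quotscaleDl q : {morph quotscale^~ q : a b / a + b}.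
Proof.
move=> a b; have [x ->] := quotproj_surj q.
by rewrite !quotscaleE scalerDl quotprojD.
Qed.
HB.instance Definition _ := GRing.Zmodule_isLmodule.Build R quotmod
  quotscaleA quotscale1 quotscaleDr quotscaleDl.

Fact quotproj_linear : linear quotproj.
Proof. by move=> a x y; rewrite quotprojD -quotscaleE. Qed.
HB.instance Definition _ := GRing.isLinear.Build R M quotmod *:%R quotproj
  quotproj_linear.

End QuotientModule.

Definition bilinear_map (R : pzRingType) (M V P : lmodType R)
    (b : M -> V -> P) : Prop :=
  (forall v, linear (b^~ v)) /\ (forall m, linear (b m)).

(* [tensor M V] consists of the finite formal sums of pairs [(m, v)], encoded
   as lists, modulo the least congruence for concatenation that makes the sum
   commutative and [(m, v)] bilinear in [m] and [v].  The universal property is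
   [tensor_liftE] with [tensor_lift_uniq]. *)
Inductive tensor_eq (R : comPzRingType) (M V : lmodType R) :
    seq (M * V) -> seq (M * V) -> Prop :=
| tensor_eq_refl s : tensor_eq s s
| tensor_eq_sym s t : tensor_eq s t -> tensor_eq t s
| tensor_eq_trans t s u : tensor_eq s t -> tensor_eq t u -> tensor_eq s u
| tensor_eq_cat s s' t t' :
    tensor_eq s s' -> tensor_eq t t' -> tensor_eq (s ++ t) (s' ++ t')
| tensor_eq_comm s t : tensor_eq (s ++ t) (t ++ s)
| tensor_eq_addl m m' v :
    tensor_eq [:: (m + m', v)] [:: (m, v); (m', v)]
| tensor_eq_addr m v v' :
    tensor_eq [:: (m, v + v')] [:: (m, v); (m, v')]
| tensor_eq_scale a m v : tensor_eq [:: (a *: m, v)] [:: (m, a *: v)]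
| tensor_eq_zero v : tensor_eq [:: (0, v)] [::].

Section Tensor.
Variables (R : comPzRingType) (M V : lmodType R).
Implicit Types (s t : seq (M * V)) (m : M) (v : V) (a : R).

Definition tensor_rel : rel (seq (M * V)) := fun s t => `[< tensor_eq s t >].

Fact tensor_rel_equiv : equiv_class_of tensor_rel.
Proof.
split=> [s | s t | t s u]; first exact/asboolP/tensor_eq_refl.
  by apply/asboolP/asboolP; apply: tensor_eq_sym.
by move=> /asboolP st /asboolP tu; apply/asboolP/(tensor_eq_trans st).
Qed.
Canonical tensor_equiv := EquivRelPack tensor_rel_equiv.

Definition tensor : Type := {eq_quot tensor_rel}.
HB.instance Definition _ := Choice.on tensor.

Definition tensor_of s : tensor := \pi_({eq_quot tensor_rel}) s.
Definition tensor_repr (x : tensor) : seq (M * V) :=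
  repr (x : {eq_quot tensor_rel}).

Lemma tensor_ofP s t : tensor_of s = tensor_of t <-> tensor_eq s t.
Proof. by split=> [/eqmodP/asboolP // | st]; apply/eqmodP/asboolP. Qed.

Lemma tensor_reprK x : tensor_of (tensor_repr x) = x.
Proof. by rewrite /tensor_of /tensor_repr reprK. Qed.

Lemma tensor_repr_of s : tensor_eq (tensor_repr (tensor_of s)) s.
Proof. by apply/tensor_ofP; rewrite tensor_reprK. Qed.

Definition tensor_zero : tensor := tensor_of [::].
Definition tensor_add (x y : tensor) : tensor :=
  tensor_of (tensor_repr x ++ tensor_repr y).
Definition tensor_scale a (x : tensor) : tensor :=
  tensor_of [seq (a *: q.1, q.2) | q <- tensor_repr x].
Definition tensor_opp : tensor -> tensor := tensor_scale (-1).

Lemma tensor_addE s t :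
  tensor_add (tensor_of s) (tensor_of t) = tensor_of (s ++ t).
Proof. by apply/tensor_ofP/tensor_eq_cat; apply: tensor_repr_of. Qed.

Lemma tensor_eq_map_scale a s t : tensor_eq s t ->
  tensor_eq [seq (a *: q.1, q.2) | q <- s] [seq (a *: q.1, q.2) | q <- t].
Proof.
elim=> {s t} /=.
- by move=> s; apply: tensor_eq_refl.
- by move=> s t _; apply: tensor_eq_sym.
- by move=> t s u _ st _; apply: tensor_eq_trans.
- by move=> s s' t t' _ ss' _ tt'; rewrite !map_cat; apply: tensor_eq_cat.
- by move=> s t; rewrite !map_cat; apply: tensor_eq_comm.
- by move=> m m' v; rewrite scalerDr; apply: tensor_eq_addl.
- by move=> m v v'; apply: tensor_eq_addr.
- move=> b m v; rewrite scalerA mulrC -scalerA.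
  exact: tensor_eq_scale.
- by move=> v; rewrite scaler0; apply: tensor_eq_zero.
Qed.

Lemma tensor_scaleE a s :
  tensor_scale a (tensor_of s) = tensor_of [seq (a *: q.1, q.2) | q <- s].
Proof. by apply/tensor_ofP/tensor_eq_map_scale/tensor_repr_of. Qed.

Lemma tensor_ofW (P : tensor -> Prop) :
  (forall s, P (tensor_of s)) -> forall x, P x.
Proof. by move=> Ps x; rewrite -(tensor_reprK x). Qed.

Fact tensor_addA : associative tensor_add.
Proof.
elim/tensor_ofW=> s; elim/tensor_ofW=> t; elim/tensor_ofW=> u.
by rewrite !tensor_addE catA.
Qed.
Fact tensor_addC : commutative tensor_add.
Proof.
elim/tensor_ofW=> s; elim/tensor_ofW=> t.
by rewrite !tensor_addE; apply/tensor_ofP/tensor_eq_comm.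
Qed.
Fact tensor_add0 : left_id tensor_zero tensor_add.
Proof. by elim/tensor_ofW=> s; rewrite /tensor_zero tensor_addE. Qed.

Fact tensor_scaleDl x a b :
  tensor_scale (a + b) x = tensor_add (tensor_scale a x) (tensor_scale b x).
Proof.
elim/tensor_ofW: x => s; rewrite !tensor_scaleE tensor_addE.
elim: s => [|[m v] s IHs] //=; apply/tensor_ofP; rewrite scalerDl.
move/tensor_ofP: IHs => IHs.
apply: tensor_eq_trans (tensor_eq_cat (tensor_eq_addl _ _ _) IHs) _ => /=.
rewrite -[X in tensor_eq X _]cat1s -[X in tensor_eq _ X]cat1s.
apply: tensor_eq_cat (tensor_eq_refl _) _.
rewrite -cat_rcons -cats1 -cat_cons; apply: tensor_eq_cat _ (tensor_eq_refl _).
exact: (tensor_eq_comm [:: _]).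
Qed.

Fact tensor_scale0 x : tensor_scale 0 x = tensor_zero.
Proof.
elim/tensor_ofW: x => s; rewrite tensor_scaleE; apply/tensor_ofP.
elim: s => [|[m v] s IHs] /=; first exact: tensor_eq_refl.
by rewrite scale0r; apply: tensor_eq_cat (tensor_eq_zero _ _) IHs.
Qed.

Fact tensor_scale1 : left_id 1 tensor_scale.
Proof.
elim/tensor_ofW=> s; rewrite tensor_scaleE; congr tensor_of.
by rewrite -[RHS]map_id; apply: eq_map => -[m v]; rewrite /= scale1r.
Qed.

Fact tensor_addN : left_inverse tensor_zero tensor_opp tensor_add.
Proof.
by move=> x; rewrite -{2}(tensor_scale1 x) -tensor_scaleDl addNr tensor_scale0.
Qed.

HB.instance Definition _ := GRing.isZmodule.Build tensor
  tensor_addA tensor_addC tensor_add0 tensor_addN.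

Fact tensor_scaleA a b x :
  tensor_scale a (tensor_scale b x) = tensor_scale (a * b) x.
Proof.
elim/tensor_ofW: x => s; rewrite !tensor_scaleE -map_comp; congr tensor_of.
by apply: eq_map => -[m v]; rewrite /= scalerA.
Qed.
Fact tensor_scaleDr : right_distributive tensor_scale +%R.
Proof.
move=> a; elim/tensor_ofW=> s; elim/tensor_ofW=> t.
by rewrite [_ + _]tensor_addE !tensor_scaleE [RHS]tensor_addE map_cat.
Qed.
HB.instance Definition _ := GRing.Zmodule_isLmodule.Build R tensor
  tensor_scaleA tensor_scale1 tensor_scaleDr tensor_scaleDl.

Definition pure_tensor m v : tensor := tensor_of [:: (m, v)].

Lemma pure_tensor_bilinear : bilinear_map pure_tensor.
Proof.
split=> [v a m m' | m a v v'].
  rewrite [LHS](tensor_ofP _ [:: (a *: m, v); (m', v)]).2.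
    by rewrite [a *: pure_tensor _ _]tensor_scaleE [RHS]tensor_addE.
  exact: tensor_eq_addl.
rewrite [LHS](tensor_ofP _ [:: (m, a *: v); (m, v')]).2.
  rewrite [a *: pure_tensor _ _]tensor_scaleE [RHS]tensor_addE; apply/tensor_ofP.
  apply: (tensor_eq_cat (s := [:: _]) (s' := [:: _])); last exact: tensor_eq_refl.
  exact/tensor_eq_sym/tensor_eq_scale.
exact: tensor_eq_addr.
Qed.

Lemma tensor_of_sum s : tensor_of s = \sum_(q <- s) pure_tensor q.1 q.2.
Proof.
elim: s => [|[m v] s IHs]; first by rewrite big_nil.
by rewrite big_cons -IHs [RHS]tensor_addE.
Qed.

Section Lift.
Variables (P : lmodType R) (b : M -> V -> P).

Definition tensor_lift (x : tensor) : P :=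
  \sum_(q <- tensor_repr x) b q.1 q.2.

Hypothesis bP : bilinear_map b.

Let bDl m m' v : b (m + m') v = b m v + b m' v.
Proof. by have := bP.1 v 1 m m'; rewrite !scale1r. Qed.
Let bDr m v v' : b m (v + v') = b m v + b m v'.
Proof. by have := bP.2 m 1 v v'; rewrite !scale1r. Qed.
Let b0l v : b 0 v = 0.
Proof. by apply: (addIr (b 0 v)); rewrite -bDl !add0r. Qed.
Let b0r m : b m 0 = 0.
Proof. by apply: (addIr (b m 0)); rewrite -bDr !add0r. Qed.
Let bZl a m v : b (a *: m) v = a *: b m v.
Proof. by have := bP.1 v a m 0; rewrite b0l !addr0. Qed.
Let bZr a m v : b m (a *: v) = a *: b m v.
Proof. by have := bP.2 m a v 0; rewrite b0r !addr0. Qed.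

Lemma tensor_eq_lift s t : tensor_eq s t ->
  \sum_(q <- s) b q.1 q.2 = \sum_(q <- t) b q.1 q.2.
Proof.
elim=> {s t} //.
- by move=> t s u _ -> _ ->.
- by move=> s s' t t' _ ss' _ tt'; rewrite !big_cat ss' tt'.
- by move=> s t; rewrite !big_cat /= addrC.
- by move=> m m' v; rewrite !big_cons !big_nil !addr0 bDl.
- by move=> m v v'; rewrite !big_cons !big_nil !addr0 bDr.
- by move=> a m v; rewrite !big_cons !big_nil !addr0 bZl bZr.
- by move=> v; rewrite big_cons !big_nil addr0 b0l.
Qed.

Lemma tensor_lift_of s :
  tensor_lift (tensor_of s) = \sum_(q <- s) b q.1 q.2.
Proof. exact/tensor_eq_lift/tensor_repr_of. Qed.

Lemma tensor_liftE m v : tensor_lift (pure_tensor m v) = b m v.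
Proof. by rewrite tensor_lift_of big_cons big_nil addr0. Qed.

Lemma tensor_lift_linear : linear tensor_lift.
Proof.
move=> a; elim/tensor_ofW=> s; elim/tensor_ofW=> t.
rewrite [a *: _]tensor_scaleE [_ + _]tensor_addE !tensor_lift_of big_cat /=.
rewrite big_map scaler_sumr; congr (_ + _); apply: eq_bigr => q _.
exact: bZl.
Qed.

Lemma tensor_lift_uniq (f : {linear tensor -> P}) :
  (forall m v, f (pure_tensor m v) = b m v) -> f =1 tensor_lift.
Proof.
move=> fb; elim/tensor_ofW=> s; rewrite tensor_lift_of tensor_of_sum.
by rewrite linear_sum; apply: eq_bigr => q _.
Qed.

End Lift.
End Tensor.

Section TensorMap.
Variables (R : comPzRingType) (W M M' : lmodType R) (f : {linear M -> M'}).

Definition tensor_map : tensor W M -> tensor W M' :=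
  tensor_lift (fun w m => pure_tensor w (f m)).

Fact tensor_map_bilinear :
  bilinear_map (fun (w : W) (m : M) => pure_tensor w (f m)).
Proof.
have [bl br] := pure_tensor_bilinear W M'; split=> [m | w a m m'].
  exact: (bl (f m)).
by rewrite linearP; apply: br.
Qed.

Lemma tensor_mapE w m : tensor_map (pure_tensor w m) = pure_tensor w (f m).
Proof. exact: tensor_liftE tensor_map_bilinear _ _. Qed.

HB.instance Definition _ := GRing.isLinear.Build R (tensor W M) (tensor W M')
  *:%R tensor_map (tensor_lift_linear tensor_map_bilinear).

End TensorMap.
Arguments tensor_map {R} W {M M'} f.

Definition pure_map (R : comPzRingType) (M M' : lmodType R)
    (f : {linear M -> M'}) : Prop :=
  forall W : lmodType R, injective (tensor_map W f).

Definition finitely_generated (R : pzRingType) (M : lmodType R)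
    (N : {pred M}) : Prop :=
  exists (n : nat) (g : 'I_n -> M),
    forall x, x \in N <-> exists a : 'I_n -> R, x = \sum_(i < n) a i *: g i.

Definition noetherian (R : comPzRingType) : Prop :=
  forall I : submodClosed R^o, finitely_generated I.

Definition prime_ideal (R : comPzRingType) (P : submodClosed R^o) : Prop :=
  (1 : R^o) \notin P /\
  forall a b : R^o, a * b \in P -> a \in P \/ b \in P.

Definition minimal_prime (R : comPzRingType) (P : submodClosed R^o) : Prop :=
  prime_ideal P /\
  forall Q : submodClosed R^o, prime_ideal Q ->
    {subset Q <= P} -> {subset P <= Q}.

(* membership in $R^\circ$ *)
Definition outside_min_primes (R : comPzRingType) (c : R) : Prop :=
  forall P : submodClosed R^o, minimal_prime P -> (c : R^o) \notin P.

(* [p \in [pchar R]] requires a nonzero ring. *)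
Definition has_prime_char (p : nat) (R : comPzRingType) : Prop :=
  prime p /\ p%:R = 0 :> R.

Section Frobenius.
Variables (p : nat) (R : comPzRingType) (charR : has_prime_char p R).

(* The ring $R^{(-e)}$; the arguments [charR] and [e] determine its $R$-module
   structure, and [frob_elt e r] is $r^{(-e)}$. *)
Definition frob_ring of has_prime_char p R & nat : Type := R.

Definition frob_elt (e : nat) (r : R) : frob_ring charR e := r.

Section Power.
Variable e : nat.
Local Notation Re := (frob_ring charR e).

HB.instance Definition _ := GRing.ComPzRing.on Re.

Definition frobenius (a : R) : Re := frob_elt e (a ^+ (p ^ e)).

Fact frobenius1D (x y : R) : (x + y) ^+ p = x ^+ p + y ^+ p.
Proof.
have [p_pr p0] := charR; have defp := prednK (prime_gt0 p_pr).
rewrite exprDn big_ord_recl -defp big_ord_recr /= /bump /= add1n defp.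
rewrite subn0 subnn !expr0 mulr1 mul1r bin0 binn !mulr1n big1 ?add0r // => i _.
have /dvdnP[k ->] : (p %| 'C(p, 1 + i))%N.
  by apply: prime_dvd_bin; rewrite //= add1n -{2}defp ltnS ltn_ord.
by rewrite mulrnA -[_ *+ p]mulr_natl p0 mul0r.
Qed.

Fact frobenius_zmod : zmod_morphism frobenius.
Proof.
move=> x y; suff D u v : frobenius (u + v) = frobenius u + frobenius v.
  by apply: (addIr (frobenius y)); rewrite -D !addrNK.
rewrite /frobenius /frob_elt; elim: e => [|n IHn]; first by rewrite expn0 !expr1.
by rewrite expnSr !exprM IHn frobenius1D.
Qed.
Fact frobenius_monoid : monoid_morphism frobenius.
Proof.
by split=> [|x y]; rewrite /frobenius /frob_elt ?expr1n ?exprMn_comm //;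
  apply: mulrC.
Qed.
HB.instance Definition _ := GRing.isZmodMorphism.Build R Re frobenius
  frobenius_zmod.
HB.instance Definition _ := GRing.isMonoidMorphism.Build R Re frobenius
  frobenius_monoid.

Definition frob_scale (a : R) (r : Re) : Re := frobenius a * r.

Fact frob_scaleA a b r : frob_scale a (frob_scale b r) = frob_scale (a * b) r.
Proof. by rewrite /frob_scale rmorphM mulrA. Qed.
Fact frob_scale1 : left_id 1 frob_scale.
Proof. by move=> r; rewrite /frob_scale rmorph1 mul1r. Qed.
Fact frob_scaleDr : right_distributive frob_scale +%R.
Proof. by move=> a r s; apply: mulrDr. Qed.
Fact frob_scaleDl r : {morph frob_scale^~ r : a b / a + b}.
Proof. by move=> a b; rewrite /frob_scale rmorphD mulrDl. Qed.
HB.instance Definition _ := GRing.Zmodule_isLmodule.Build R Re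
  frob_scaleA frob_scale1 frob_scaleDr frob_scaleDl.

Definition mul_frobenius (c : R) (x : R^o) : Re := frob_elt e (c * x ^+ (p ^ e)).

Fact mul_frobenius_linear c : linear (mul_frobenius c).
Proof.
move=> a x y; have -> z : mul_frobenius c z = frob_elt e c * frobenius z by [].
have -> : mul_frobenius c x = frob_elt e c * frobenius x by [].
have -> : mul_frobenius c y = frob_elt e c * frobenius y by [].
rewrite rmorphD rmorphM mulrDr; congr (_ + _).
by rewrite mulrCA.
Qed.
HB.instance Definition _ c := GRing.isLinear.Build R R^o Re *:%R
  (mul_frobenius c) (mul_frobenius_linear c).

End Power.

Definition F_finite : Prop :=
  finitely_generated (predT : {pred frob_ring charR 1}).

(* $x \in \operatorname{Cl}_R(N, M)$ *)
Definition in_closure (M : lmodType R) (N : submodClosed M) (x : M) : Prop :=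
  exists c : R, outside_min_primes c /\
  exists e0 : nat, (1 <= e0)%N /\
  forall e : nat, (e0 <= e)%N ->
    pure_tensor (quotproj N x) (frob_elt e c) = 0
      :> tensor (quotmod N) (frob_ring charR e).

Definition strongly_F_regular : Prop :=
  noetherian R /\
  forall (M : lmodType R) (N : submodClosed M) (x : M),
    in_closure N x <-> x \in N.

Definition very_strongly_F_regular : Prop :=
  noetherian R /\
  forall c : R, outside_min_primes c ->
    exists e : nat, (0 < e)%N /\ pure_map (mul_frobenius e c).

End Frobenius.

(* Main.v *)
(* For [e >= 1] let [I_e] be the ideal of values at [c] of the [R]-linear maps
   [R^(-e) -> R], so that [c^(-e) F^e] splits as soon as [1 \in I_e].  Since
   [R^(-e)] is finitely presented, there is a universal module containing an
   element [w] with [w (x) c^(-e) = 0], and the annihilator of [w] in it is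
   exactly [I_e].  Strong F-regularity applied to [c = 1] thus gives a splitting
   of Frobenius, which makes the [I_e] increase with [e].  If their union [I] were
   proper, amalgamating the universal modules for all [e >= 1] along [w] would
   give a nonzero element, whose annihilator is contained in [I], in the closure
   of [0]. *)
Require Import Defs.
From HB Require Import structures.
From mathcomp Require Import all_boot all_algebra.
From mathcomp Require Import boolp functions.

Set Implicit Arguments.
Unset Strict Implicit.
Unset Printing Implicit Defensive.

Import GRing.Theory.
Local Open Scope ring_scope.

(** * Submodules, linear functions and finite generation *)

Section SubmodOfProp.
Variables (R : pzRingType) (V : lmodType R) (P : V -> Prop).
Hypotheses (P0 : P 0) (PD : forall a x y, P x -> P y -> P (a *: x + y)).

Definition prop_pred of P 0 & (forall a x y, P x -> P y -> P (a *: x + y)) :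
  V -> bool := fun x => `[< P x >].

Local Notation S := (prop_pred P0 PD).

Fact prop_pred_submod : GRing.submod_closed S.
Proof.
split=> [|a x y /asboolP Px /asboolP Py]; first exact/asboolP.
exact/asboolP/PD.
Qed.
HB.instance Definition _ := GRing.isSubmodClosed.Build R V S prop_pred_submod.

Lemma submod_of_prop : exists N : submodClosed V, forall x, x \in N <-> P x.
Proof.
exists (GRing.SubmodClosed.clone R V S _) => x.
by split=> [/asboolP | Px]; last exact/asboolP.
Qed.

End SubmodOfProp.

Section LinearFunctions.
Variables (R : pzRingType) (U V W : lmodType R) (f : U -> V).
Hypothesis f_lin : linear f.

Lemma linear_fun0 : f 0 = 0.
Proof.
by apply: (addIr (f 0)); have := f_lin 1 0 0; rewrite !scale1r !add0r.
Qed.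

Lemma linear_funZ a x : f (a *: x) = a *: f x.
Proof. by have := f_lin a x 0; rewrite linear_fun0 !addr0. Qed.

Lemma linear_fun_sum (I : Type) (r : seq I) (g : I -> U) :
  f (\sum_(i <- r) g i) = \sum_(i <- r) f (g i).
Proof.
elim: r => [|i r IHr]; rewrite ?big_nil ?linear_fun0 // !big_cons -IHr.
by have := f_lin 1 (g i) (\sum_(j <- r) g j); rewrite !scale1r.
Qed.

Lemma linear_sumZ (I : Type) (r : seq I) (a : I -> R) (g : I -> U) :
  f (\sum_(i <- r) a i *: g i) = \sum_(i <- r) a i *: f (g i).
Proof.
by rewrite linear_fun_sum; apply: eq_bigr => i _; rewrite linear_funZ.
Qed.

Lemma linear_fun_comp (h : V -> W) : linear h -> linear (h \o f).
Proof. by move=> h_lin a x y; rewrite /= f_lin h_lin. Qed.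

End LinearFunctions.

Section FinitelyGenerated.
Variables (R : pzRingType) (M : lmodType R).

(** Indexing by [nat], with zeros from [n] on, keeps [n] out of the types, so that families with
    varying [n] can be chosen together. *)
Lemma fg_nat (N : {pred M}) : finitely_generated N ->
  exists (n : nat) (g : nat -> M), (forall i, g i \in N) /\
    forall x, x \in N -> exists a : nat -> R, x = \sum_(i < n) a i *: g i.
Proof.
case=> n [g gP]; pose ext (T : Type) (z : T) (h : 'I_n -> T) (i : nat) :=
  if insub i is Some j then h j else z.
have extE T z (h : 'I_n -> T) (i : 'I_n) : ext T z h i = h i.
  by rewrite /ext valK.
exists n, (ext M 0 g); split=> [i | x /gP[a ->]].
  rewrite /ext; case: insubP => [j _ _|_]; apply/gP; last first.
    by exists (fun=> 0); rewrite big1 // => k _; rewrite scale0r.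
  exists (fun k => (k == j)%:R).
  rewrite (bigD1 j) //= eqxx scale1r big1 ?addr0 //.
  by move=> k /negbTE->; rewrite scale0r.
by exists (ext R 0 a); apply: eq_bigr => i _; rewrite !extE.
Qed.

End FinitelyGenerated.

(** * Finite presentations over a noetherian ring *)

Section Presentation.
Variable R : comPzRingType.
Hypothesis R_noeth : noetherian R.

(** Induction on [n]: generators for the first [n] coordinates are completed by elements of [K] that
    vanish there and whose [n]-th coordinates generate the ideal of all such coordinates. *)
Lemma noetherian_free_submod (K : submodClosed (nat -> R^o)) (n : nat) :
  exists (m : nat) (A : nat -> nat -> R),
    (forall j, (A j : nat -> R^o) \in K) /\
    forall k, k \in K -> exists b : nat -> R,
      forall i, (i < n)%N -> k i = \sum_(j < m) b j * A j i.
Proof.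
elim: n => [|n [m [A [AK Aspan]]]].
  exists 0%N, (fun=> (0 : nat -> R^o)); split=> [j|k _]; first exact: rpred0.
  by exists (fun=> 0).
pose P (a : R^o) := exists2 k, k \in K &
  (forall i, (i < n)%N -> k i = 0) /\ k n = a.
have P0 : P 0 by exists 0; first exact: rpred0.
have PD a x y : P x -> P y -> P (a *: x + y).
  move=> [k kK [k0 kn]] [l lK [l0 ln]]; exists (a *: k + l).
    by rewrite rpredD ?rpredZ.
  split=> [i i_n|]; rewrite addrfctE scalrfctE.
    by rewrite k0 // l0 // scaler0 addr0.
  by rewrite kn ln.
have [J JP] := submod_of_prop P0 PD.
have [m' [a [aJ aspan]]] := fg_nat (R_noeth J).
have /choice[B BP] : forall j, exists k : nat -> R^o, k \in K /\
    ((forall i, (i < n)%N -> k i = 0) /\ k n = a j).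
  by move=> j; have /JP[k kK k0] := aJ j; exists k.
exists (m + m')%N, (fun j => if (j < m)%N then A j else B (j - m)%N).
split=> [j|k kK]; first by case: ifP => _; [exact: AK | case: (BP (j - m)%N)].
have [b bP] := Aspan _ kK.
(* Clearing the coordinates below [n] leaves an element of [K] whose [n]-th coordinate lies in
   [J]. *)
pose k1 := (-1) *: \sum_(j < m) b j *: (A j : nat -> R^o) + k.
have k1K : k1 \in K.
  by rewrite rpredD // rpredZ // rpred_sum // => j _; rewrite rpredZ.
have k1E i : k1 i = k i - \sum_(j < m) b j * A j i.
  by rewrite /k1 scaleN1r addrC addrfctE opprfctE fct_sumE.
have k10 i : (i < n)%N -> k1 i = 0 by move=> i_n; rewrite k1E bP // subrr.
have /aspan[b' b'P] : k1 n \in J by apply/JP; exists k1.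
exists (fun j => if (j < m)%N then b j else b' (j - m)%N) => i.
rewrite big_split_ord /=.
under eq_bigr => j _ do rewrite ltn_ord.
under [X in _ + X]eq_bigr => j _ do rewrite ltnNge leq_addr /= addKn.
have -> : k i = \sum_(j < m) b j * A j i + k1 i by rewrite k1E addrC subrK.
rewrite ltnS leq_eqVlt => /predU1P[->|i_n]; congr (_ + _).
  by rewrite b'P; apply: eq_bigr => j _; case: (BP j) => _ [_ ->].
rewrite k10 // big1 // => j _; have [_ [B0 _]] := BP j.
by rewrite B0 // mulr0.
Qed.

(* [F] has [n] generators and the [m] relations [A], and [f] has coordinates [v];
   the conclusion retains only what does not mention the generators. *)
Lemma fg_dual_presentation (F : lmodType R) (f : F) :
  finitely_generated (predT : {pred F}) ->
  exists (n m : nat) (v : nat -> R) (A : nat -> nat -> R),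
  (forall (W : lmodType R) (w : W) (y : nat -> W),
    (forall i, (i < n)%N -> v i *: w = \sum_(j < m) A j i *: y j) ->
    pure_tensor w f = 0) /\
  (forall u : nat -> R,
    (forall j, (j < m)%N -> \sum_(i < n) u i * A j i = 0) ->
    exists2 h : F -> R^o, linear h & h f = \sum_(i < n) u i * v i).
Proof.
move=> /fg_nat[n [g [_ gspan]]].
have /choice[co coP] : forall x, exists a : nat -> R,
    x = \sum_(i < n) a i *: g i.
  by move=> x; apply: gspan.
(* The relations among the generators [g]. *)
pose P (k : nat -> R^o) := \sum_(i < n) k i *: g i = 0.
have P0 : P 0 by rewrite /P big1 // => i _; rewrite scale0r.
have PD a x y : P x -> P y -> P (a *: x + y).
  rewrite /P => xP yP; under eq_bigr => i _.
    by rewrite addrfctE scalrfctE scalerDl -[(a *: x i) *: _]scalerA over.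
  by rewrite big_split /= -scaler_sumr xP yP scaler0 addr0.
have [K KP] := submod_of_prop P0 PD.
have [m [A [AK Aspan]]] := noetherian_free_submod K n.
exists n, m, (co f), A; split=> [W w y wy | u uA].
  (* The relations move across the tensor sign: [w (x) f] becomes the sum over [j] of
     [y j (x) \sum_i A j i *: g i], whose right factors vanish. *)
  rewrite {1}(coP f) (linear_sumZ ((pure_tensor_bilinear W F).2 w)).
  have -> : \sum_(i < n) co f i *: pure_tensor w (g i) =
      \sum_(i < n) \sum_(j < m) A j i *: pure_tensor (y j) (g i).
    apply: eq_bigr => i _; have bl := (pure_tensor_bilinear W F).1 (g i).
    by rewrite -(linear_funZ bl) wy // (linear_sumZ bl).
  rewrite exchange_big big1 // => j _.
  have br := (pure_tensor_bilinear W F).2 (y j).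
  by rewrite -(linear_sumZ br) (KP _).1 ?AK ?(linear_fun0 br).
have uK k : k \in K -> \sum_(i < n) u i * k i = 0.
  move=> /Aspan[b bP]; under eq_bigr => i _.
    rewrite bP // mulr_sumr; under eq_bigr do rewrite mulrCA.
    by over.
  rewrite exchange_big big1 // => j _.
  by rewrite -mulr_sumr uA // mulr0.
(* The coordinates [co] are chosen without linearity, but their defect of linearity lies in [K], on
   which [u] vanishes. *)
exists (fun x => \sum_(i < n) u i * co x i) => // a x y; apply/eqP.
rewrite -subr_eq0 scaler_sumr -big_split -sumrB /=; apply/eqP.
have kK : ((co (a *: x + y) : nat -> R^o) -
    (a *: (co x : nat -> R^o) + co y)) \in K.
  apply/KP; rewrite /P.
  under eq_bigr => i _ do rewrite addrfctE opprfctE scalerBl addrfctE scalrfctE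
     scalerDl -[(a *: (co x i : R^o)) *: _]scalerA.
  by rewrite sumrB big_split /= -scaler_sumr -!coP subrr.
rewrite -[RHS](uK _ kK); apply: eq_bigr => i _.
rewrite [in RHS]addrfctE opprfctE addrfctE scalrfctE mulrBr mulrDr.
by congr (_ - (_ + _)); apply: mulrCA.
Qed.

End Presentation.

(* [M / N] is the amalgamated sum along [w] of the universal modules with
   [w (x) f t = 0]: the first factor of [M] is [R w], the second one contains
   the remaining generators [y t j], and the relations are the sums of the
   [row t u].  A product serves as well as a direct sum for the [y t j]. *)
Lemma universal_killing (R : comPzRingType) (F : nat -> lmodType R)
    (f : forall t, F t) (I : submodClosed R^o) :
  noetherian R ->
  (forall t, finitely_generated (predT : {pred F t})) ->
  (forall t (h : F t -> R^o), linear h -> h (f t) \in I) ->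
  (1 : R^o) \notin I ->
  exists (M : lmodType R) (N : submodClosed M) (w : M), w \notin N /\
    forall t, pure_tensor (quotproj N w) (f t) = 0.
Proof.
move=> R_noeth F_fg fI I1.
have presF t := fg_dual_presentation R_noeth (f t) (F_fg t).
have [n /choice[m /choice[v /choice[A nmvA]]]] := choice presF.
pose M : lmodType R := (R^o * (nat -> nat -> R^o))%type.
pose dot t (u x : nat -> R) := \sum_(i < n t) u i * x i.
(* The combination, with coefficients [u i], of the relations
   [v t i *: w - \sum_j A t j i *: y t j]. *)
pose row t (u : nat -> R) : M :=
  (dot t u (v t), fun t' j => - dot t u (A t j) *+ ((t' == t) && (j < m t)%N)).
have row_lin t a u u' :
    row t (fun i => a * u i + u' i) = a *: row t u + row t u'.
  have dotD x : dot t (fun i => a * u i + u' i) x = a * dot t u x + dot t u' x.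
    rewrite /dot mulr_sumr -big_split; apply: eq_bigr => i _ /=.
    by rewrite mulrDl mulrA.
  congr pair; first exact: dotD.
  apply/funext => t'; apply/funext => j.
  rewrite dotD -[RHS]/(a * (- dot t u (A t j) *+ ((t' == t) && (j < m t)%N)) +
    - dot t u' (A t j) *+ ((t' == t) && (j < m t)%N)).
  by case: (_ && _); rewrite ?mulr1n ?mulr0n ?opprD ?mulrN ?mulr0 ?addr0.
have row0 t : row t (fun=> 0) = 0.
  have := row_lin t (-1) (fun=> 0) (fun=> 0).
  by rewrite scaleN1r addNr => <-; congr row; apply/funext => i;
    rewrite mulr0 addr0.
pose P (x : M) := exists (E : nat) (u : nat -> nat -> R),
  x = \sum_(t < E) row t (u t).
have widen E E' (u : nat -> nat -> R) : (E <= E')%N ->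
    \sum_(t < E) row t (u t) =
    \sum_(t < E') row t (fun i => if (t < E)%N then u t i else 0).
  move=> EE'; rewrite (big_ord_widen E' (fun t => row t (u t))) // big_mkcond.
  by apply: eq_bigr => t _; case: ifP => //; rewrite row0.
have P0 : P 0 by exists 0%N, (fun _ _ => 0); rewrite big_ord0.
have PD a x y : P x -> P y -> P (a *: x + y).
  move=> [E [u ->]] [E' [u' ->]].
  exists (E + E')%N.
  rewrite (widen E _ u (leq_addr E' E)) (widen E' _ u' (leq_addl E E')).
  exists (fun (t i : nat) => a * (if (t < E)%N then u t i else 0) +
                     if (t < E')%N then u' t i else 0).
  under [RHS]eq_bigr do rewrite row_lin.
  by rewrite big_split scaler_sumr.
have [N NP] := submod_of_prop P0 PD.
have fst_sum r (G : nat -> M) : (\sum_(i < r) G i).1 = \sum_(i < r) (G i).1.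
  by elim/big_rec2: _ => // i y x _ <-.
have snd_sum r (G : nat -> M) t j :
    (\sum_(i < r) G i).2 t j = \sum_(i < r) (G i).2 t j.
  by elim/big_rec2: _ => // i y x _ <-.
exists M, N, (1, 0); split.
  (* If [w] were in [N], the second components would make each [u t] orthogonal to the [A t j], and
     the first ones would write 1 as a sum of values of linear maps at the [f t]. *)
  apply/negP => /NP[E [u uE]]; case/negP: I1.
  have := congr1 fst uE; rewrite (fst_sum _ (fun t => row t (u t))) /= => ->.
  apply: rpred_sum => t _.
  have [_ /(_ (u t))[j jm|h h_lin hE]] := nmvA t; last first.
    by rewrite /dot -hE fI.
  have := congr1 (fun x : M => x.2 t j) uE.
  rewrite (snd_sum _ (fun t => row t (u t))) (bigD1 t) //= eqxx jm mulr1n.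
  rewrite big1 => [|t' t't]; last first.
    by rewrite [_ == _](negPf _) // eq_sym.
  by rewrite addr0 => /esym/eqP; rewrite oppr_eq0 => /eqP.
move=> t; pose y j : M := (0, fun t' j' => ((t' == t) && (j' == j))%:R).
apply: (nmvA t).1 (fun j => quotproj N (y j)) _ => i i_n.
rewrite -linearZ; under eq_bigr do rewrite -linearZ.
rewrite -linear_sum; apply/quotprojP/NP.
have -> : \sum_(j < m t) A t j i *: y j =
    (0, fun t' j => A t j i *+ ((t' == t) && (j < m t)%N)).
  apply: injective_projections.
    rewrite (fst_sum _ (fun j => A t j i *: y j)) big1 // => j _.
    exact: mulr0.
  apply/funext => t'; apply/funext => j.
  rewrite (snd_sum _ (fun j => A t j i *: y j)) /=.
  rewrite -[LHS]/(\sum_(k < m t) A t k i * ((t' == t) && (j == k))%:R).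
  case: (t' == t); last by rewrite big1 // => k _; rewrite mulr0.
  case: ltnP => [jm | mj].
    rewrite (bigD1 (Ordinal jm)) //= eqxx mulr1 big1 ?addr0 // => k jk.
    by rewrite eq_sym (negPf (jk : (k : nat) != j)) mulr0.
  by rewrite big1 // => k _; rewrite gtn_eqF ?mulr0 // (leq_trans _ mj).
(* The [i]-th relation is [row t] at the [i]-th unit vector; the rows before it are zero. *)
exists t.+1, (fun t' i' => ((t' == t) && (i' == i))%:R).
rewrite (bigD1 ord_max) //= big1 => [|t' t't]; last first.
  rewrite [X in row _ X](_ : _ = fun=> 0) ?row0 //; apply/funext => i'.
  by rewrite (negPf (t't : (t' : nat) != t)).
have dot_delta x : dot t (fun i' => ((t == t) && (i' == i))%:R) x = x i.
  rewrite /dot (bigD1 (Ordinal i_n)) //= !eqxx mul1r big1 ?addr0 // => i' ii'.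
  by rewrite (negPf (ii' : (i' : nat) != i)) andbF mul0r.
rewrite addr0 /row !dot_delta; congr pair.
  by rewrite -[LHS]/(v t i * 1 - 0) mulr1 subr0.
apply/funext => t'; apply/funext => j.
rewrite -[LHS]/(v t i * 0 - (A t j i *+ ((t' == t) && (j < m t)%N))).
by rewrite mulr0 sub0r dot_delta mulNrn.
Qed.

(** Tensoring the retraction [h] with [W] gives a left inverse of [tensor_map W f]. *)
Lemma split_pure (R : comPzRingType) (M M' : lmodType R) (f : {linear M -> M'})
    (h : M' -> M) : linear h -> cancel f h -> pure_map f.
Proof.
move=> h_lin fK W.
pose b (w : W) (m : M') : tensor W M := pure_tensor w (h m).
have b_bil : bilinear_map b.
  have [bl br] := pure_tensor_bilinear W M; split=> [m | w a m m'].
    exact: bl (h m).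
  by rewrite /b h_lin br.
apply: (can_inj (g := tensor_lift b)).
elim/tensor_ofW => s; rewrite tensor_of_sum linear_sum /=.
have lift_lin := tensor_lift_linear b_bil.
rewrite (linear_fun_sum lift_lin); apply: eq_bigr => q _.
by rewrite tensor_mapE tensor_liftE // /b fK.
Qed.

(** * Linear maps from [R^(-e)] to [R] and their values at [c] *)

Section FrobeniusTrace.
Variables (p : nat) (R : comPzRingType) (charR : has_prime_char p R).
Local Notation Re := (frob_ring charR).

(** If the [g j] generate [R^(-e)] and the [g1 i] generate [R^(-1)], the products [g j ^+ p * g1 i]
    generate [R^(-(e+1))]. *)
Lemma frob_ring_fg e : F_finite charR ->
  finitely_generated (predT : {pred Re e}).
Proof.
move=> R_fin; suff [n [g gspan]] : exists n (g : 'I_n -> R),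
    forall x : R, exists a : 'I_n -> R, x = \sum_(i < n) a i ^+ (p ^ e) * g i.
  by exists n, g => x; split=> // _; apply: gspan.
have [n1 [g1 g1span]] := R_fin.
elim: e => [|e [n [g gspan]]].
  exists 1%N, (fun=> 1) => x; exists (fun=> x).
  by rewrite big_ord1 expn0 expr1 mulr1.
pose T := ('I_n1 * 'I_n)%type.
exists #|{: T}|, (fun k => let q : T := enum_val k in g q.2 ^+ p * g1 q.1) => x.
have [/(_ isT)[a xE] _] := g1span x.
have /choice[b bP] : forall i, exists b : 'I_n -> R,
    a i = \sum_(j < n) b j ^+ (p ^ e) * g j by move=> i; apply: gspan.
exists (fun k => let q : T := enum_val k in b q.1 q.2).
rewrite -(big_enum_val (fun q : T =>
  b q.1 q.2 ^+ (p ^ e.+1) * (g q.2 ^+ p * g1 q.1))).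
rewrite xE -(pair_bigA _ (fun i j => b i j ^+ (p ^ e.+1) * (g j ^+ p * g1 i))).
apply: eq_bigr => i _ /=; rewrite -[LHS]/(a i ^+ (p ^ 1) * g1 i) bP.
rewrite -[_ ^+ _]/(frobenius charR 1 _) rmorph_sum mulr_suml.
apply: eq_bigr => j _; rewrite rmorphM mulrA /= /frobenius /frob_elt expn1.
congr (_ * _ * _).
by rewrite -exprM expnSr.
Qed.

Definition frob_trace e (c a : R) : Prop :=
  exists2 h : Re e -> R^o, linear h & h (frob_elt charR e c) = a.

Lemma frob_trace_submod e c :
  exists I : submodClosed R^o, forall a, a \in I <-> frob_trace e c a.
Proof.
apply: submod_of_prop => [|a x y [h h_lin <-] [k k_lin <-]].
  by exists (fun=> 0) => // a x y; rewrite scaler0 addr0.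
exists (fun z => a *: h z + k z) => // b z z'.
by rewrite h_lin k_lin !scalerDr !scalerA [a * b]mulrC addrACA.
Qed.

(** For proper [I], [universal_killing] gives [w] outside [N], while [c] and [e0 = 1] put [w] in the
    closure of [N]. *)
Lemma strongly_F_regular_trace c (I : submodClosed R^o) :
  F_finite charR -> strongly_F_regular charR -> outside_min_primes c ->
  (forall e a, (0 < e)%N -> frob_trace e c a -> a \in I) -> (1 : R^o) \in I.
Proof.
move=> R_fin [R_noeth R_reg] c_out traceI; apply: contrapT => /negP I1.
(* The index [t] stands for the exponent [t.+1], since [I] is only known to contain the values for
   positive exponents. *)
have [||M [N [w [/negP wN w0]]]] := @universal_killing R (fun t => Re t.+1)
  (fun t => frob_elt charR t.+1 c) I R_noeth _ _ I1.
- by move=> t; apply: frob_ring_fg.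
- by move=> t h h_lin; apply: (traceI t.+1) => //; exists h.
apply/wN/R_reg; exists c; split=> //; exists 1%N; split=> // -[//|e _].
exact: w0.
Qed.

(** For [c = 1], [I_1] contains every [I_e] with [e >= 1]: the power map from [R^(-1)] to [R^(-e)]
    is [R]-linear and fixes 1, so linear maps to [R] can be precomposed with it. *)
Lemma frob_trace_split : F_finite charR -> strongly_F_regular charR ->
  frob_trace 1 1 1.
Proof.
move=> R_fin R_reg; have [I IP] := frob_trace_submod 1 1.
apply/IP/(strongly_F_regular_trace (c := 1)) => //.
  by move=> P [[]].
move=> [//|e] a _ [h h_lin <-]; apply/IP.
exists (fun x : Re 1 => h (frob_elt charR e.+1 (x ^+ (p ^ e)))); last first.
  by rewrite /frob_elt expr1n.
move=> a' x y; rewrite -h_lin; congr h.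
rewrite -![frob_elt _ _ _]/(frobenius charR e _) rmorphD rmorphM.
congr (_ * _ + _); rewrite /= /frobenius /frob_elt -exprM.
by rewrite expn1 expnS.
Qed.

Lemma frob_traceS e c a : frob_trace 1 1 1 ->
  frob_trace e c a -> frob_trace e.+1 c a.
Proof.
move=> [th th_lin th1] [h h_lin <-].
(* The factor [c ^+ p.-1] makes [th'] send [c] to [th (c ^+ p) = c * th 1 = c]. *)
pose th' (x : Re e.+1) : Re e := th (c ^+ p.-1 * x).
have th'_lin : linear th'.
  move=> b x y; rewrite /th' -[RHS]/(b ^+ (p ^ e) *: (th _ : R^o) + th _).
  rewrite -th_lin mulrDr; congr (th (_ + _)).
  rewrite -[RHS]/((b ^+ (p ^ e)) ^+ (p ^ 1) * _) -exprM expn1 -expnSr.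
  exact: mulrCA.
exists (h \o th'); first exact (linear_fun_comp th'_lin h_lin).
rewrite /= /th' /frob_elt; congr h; rewrite -exprSr prednK ?prime_gt0 ?charR.1 //.
have thc := linear_funZ th_lin c (frob_elt charR 1 1).
by rewrite -[RHS]mulr1 -th1 -[RHS]thc -[c *: _]/(c ^+ (p ^ 1) * 1) mulr1 expn1.
Qed.

End FrobeniusTrace.

Theorem lemma3p9 (p : nat) (R : comPzRingType) (charR : has_prime_char p R) :
  noetherian R -> F_finite charR ->
  strongly_F_regular charR -> very_strongly_F_regular charR.
Proof.
move=> R_noeth R_fin R_reg; split=> // c c_out.
have split1 := frob_trace_split R_fin R_reg.
have traceW e e' a : (e <= e')%N -> frob_trace charR e c a ->
    frob_trace charR e' c a.
  by move=> /subnK <-; elim: (e' - e)%N => // k IHk /IHk; apply: frob_traceS.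
(* The union of the [I_e] with [e >= 1], closed under sums because the chain increases. *)
pose P (a : R^o) := exists2 e, (0 < e)%N & frob_trace charR e c a.
have [||I IP] := @submod_of_prop R R^o P.
- by exists 1%N => //; have [I IP] := frob_trace_submod charR 1 c;
    apply/IP/rpred0.
- move=> a x y [e e_gt0 xe] [e' _ ye'].
  exists (maxn e e'); first by rewrite (leq_trans e_gt0) ?leq_maxl.
  have [I IP] := frob_trace_submod charR (maxn e e') c; apply/IP.
  rewrite rpredD ?rpredZ //; apply/IP.
    exact: traceW (leq_maxl _ _) xe.
  exact: traceW (leq_maxr _ _) ye'.
have /IP[e e_gt0 [h h_lin hc]] : (1 : R^o) \in I.
  apply: (strongly_F_regular_trace R_fin R_reg c_out) => e a e_gt0 tr.
  by apply/IP; exists e.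
(* Linearity gives [h (c * x ^+ (p ^ e)) = x * h c = x], so [h] is a retraction. *)
exists e; split=> //; apply: (split_pure h_lin) => x.
have hxc := linear_funZ h_lin x (frob_elt charR e c).
rewrite -[RHS]mulr1 -hc -[RHS]hxc; congr h.
exact: mulrC.
Qed.
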